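(* For every integer $k\geq 3$, the border rank of the tensor of $k$-wise matrix multiplication (for $k$-tensors of dimensions $n\times\cdots\times n$) is exactly $n^{k+1}$.
   Context: The $k$-wise matrix product takes $k$ order-$k$ tensors $A^1,\ldots,A^k$, each of dimensions $n\times\cdots\times n$, and outputs the order-$k$ tensor $C$ with $C[i_1,\ldots,i_k]=\sum_{\ell\in[n]} A^1[i_1,\ldots,i_{k-1},\ell]\cdot A^2[i_2,\ldots,i_{k-1},\ell,i_k]\cdots A^k[\ell,i_k,i_1,\ldots,i_{k-2}]$, where the $j$-th factor $A^j$ is indexed by the cyclic window of length $k$ starting at position $j$ of the cyclic sequence $(i_1,\ldots,i_{k-1},\ell,i_k)$. This is a $k$-linear map; its tensor is the corresponding order-$(k+1)$ tensor (with one factor for each input and one for the output). The border rank of a tensor is the smallest $r$ such that it is a limit of tensors of rank at most $r$. For $k=2$ this is ordinary matrix multiplication. *)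

(* Defs.v *)
From mathcomp Require Import all_boot all_order all_algebra.
From mathcomp Require Import boolp classical_sets topology normedtype.

Set Implicit Arguments.
Unset Strict Implicit.
Unset Printing Implicit Defensive.

Import GRing.Theory.
Import numFieldNormedType.Exports.

Local Open Scope classical_set_scope.
Local Open Scope ring_scope.

(* An order-m tensor in (K^J)^{(x) m}, given by its coordinates in the
   standard basis. *)
Definition tensor (K : Type) (m : nat) (J : finType) : Type :=
  {ffun m.-tuple J -> K}.

Definition simple_tensor (K : comPzRingType) (m : nat) (J : finType)
    (v : 'I_m -> {ffun J -> K}) : tensor K m J :=
  [ffun w : m.-tuple J => \prod_(j < m) v j (tnth w j)].

Definition rank_le (K : comPzRingType) (m : nat) (J : finType)
    (T : tensor K m J) (r : nat) : Prop :=
  exists v : 'I_r -> 'I_m -> {ffun J -> K},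
    T = [ffun w => \sum_(a < r) simple_tensor (v a) w].

(* Convergence in the finite-dimensional space of tensors is convergence of
   every coordinate, for the topology of the norm of K. *)
Definition border_rank_le (K : numFieldType) (m : nat) (J : finType)
    (T : tensor K m J) (r : nat) : Prop :=
  exists S : nat -> tensor K m J,
    (forall s, rank_le (S s) r) /\
    (forall w : m.-tuple J, S s w @[s --> \oo] --> T w).

Definition is_border_rank (K : numFieldType) (m : nat) (J : finType)
    (T : tensor K m J) (r : nat) : Prop :=
  border_rank_le T r /\ forall r', border_rank_le T r' -> (r <= r')%N.

(* The tensor of a k-linear map f : (K^J)^k -> K^J: its coordinate at
   (w_0, ..., w_{k-1}, w_k) is the w_k-th coordinate of
   f (e_{w_0}, ..., e_{w_{k-1}}). *)
Definition multilinear_tensor (K : comPzRingType) (k : nat) (J : finType)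
    (f : ('I_k -> {ffun J -> K}) -> {ffun J -> K}) : tensor K k.+1 J :=
  [ffun w : k.+1.-tuple J =>
     f (fun j : 'I_k => [ffun x => (x == tnth w (widen_ord (leqnSn k) j))%:R])
       (tnth w ord_max)].

(* The cyclic sequence (i_1, ..., i_{k-1}, l, i_k). *)
Definition cyclic_indices (n k : nat) (i : k.-tuple 'I_n) (l : 'I_n) :
    seq 'I_n :=
  take k.-1 i ++ l :: drop k.-1 i.

(* Positions are counted from 0 and wrap around modulo k+1, so that nth is
   never out of range when 0 < k. *)
Definition cyclic_window (n k : nat) (i : k.-tuple 'I_n) (l : 'I_n)
    (j : 'I_k) : k.-tuple 'I_n :=
  [tuple nth l (cyclic_indices i l) ((j + t) %% k.+1)%N | t < k].

Definition kwise_product (K : comPzRingType) (n k : nat)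
    (A : 'I_k -> {ffun k.-tuple 'I_n -> K}) : {ffun k.-tuple 'I_n -> K} :=
  [ffun i : k.-tuple 'I_n =>
     \sum_(l < n) \prod_(j < k) A j (cyclic_window i l j)].

Definition kwise_tensor (K : comPzRingType) (n k : nat) :
    tensor K k.+1 (k.-tuple 'I_n) :=
  multilinear_tensor (@kwise_product K n k).

(* Main.v *)
Require Import Defs.
From mathcomp Require Import all_boot all_order all_algebra.
From mathcomp Require Import boolp classical_sets topology normedtype.

Set Implicit Arguments.
Unset Strict Implicit.
Unset Printing Implicit Defensive.

Import GRing.Theory.
Import numFieldNormedType.Exports.

Local Open Scope ring_scope.

(** The tensor is the sum, over the n^(k+1) cyclic sequences x, of the tensor
    products of the basis vectors indexed by the k+1 windows of x, each of which
    omits a different position of x.  Hence any two windows determine x.  As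
    k+1 >= 4, the factors split into two groups of at least two; the
    corresponding flattening restricts to an identity matrix of size n^(k+1),
    and flattening ranks bound border rank from below because the determinant
    is continuous. *)

Lemma cvg_det (K : numFieldType) (N : nat) (M : nat -> 'M[K]_N) (A : 'M[K]_N) :
  (forall i j, (M s i j @[s --> \oo] --> A i j)%classic) ->
  (\det (M s) @[s --> \oo] --> \det A)%classic.
Proof.
move=> MA; rewrite /determinant.
apply: cvg_big => [|sg _]; first exact: add_continuous.
apply: cvgMl_tmp; apply: cvg_big => [|i _]; first exact: mul_continuous.
exact: MA.
Qed.

Lemma det_mulmx_lt (F : fieldType) (N r : nat) (U : 'M[F]_(N, r))
    (V : 'M[F]_(r, N)) : (r < N)%N -> \det (U *m V) = 0.
Proof.
move=> ltrN; apply/eqP; apply: contraTT ltrN; rewrite -unitfE -unitmxE -leqNgt.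
move=> /mxrank_unit {1}<-.
exact: leq_trans (mxrankM_maxl _ _) (rank_leq_col _).
Qed.

(** Reading a tensor at such tuples gives its flattening along [A], with [u] as row index and [v] as
    column index. *)
Definition mix_tuple (m : nat) (J : Type) (A : pred 'I_m) (u v : m.-tuple J) :
    m.-tuple J :=
  [tuple if A j then tnth u j else tnth v j | j < m].

(** In a simple tensor the factors at positions in [A] depend only on the row and the others only on
    the column, so it flattens to a column times a row; the [r] columns and rows are collected in
    [U] and [V]. *)
Lemma rank_le_flattening (K : comPzRingType) (m : nat) (J : finType)
    (T : tensor K m J) (r : nat) (A : pred 'I_m) (N : nat)
    (u v : 'I_N -> m.-tuple J) : rank_le T r ->
  exists U : 'M[K]_(N, r), exists V : 'M[K]_(r, N),
    \matrix_(p, q) T (mix_tuple A (u p) (v q)) = U *m V.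
Proof.
case=> x ->.
exists (\matrix_(p, a) \prod_(j < m | A j) x a j (tnth (u p) j)).
exists (\matrix_(a, q) \prod_(j < m | ~~ A j) x a j (tnth (v q) j)).
apply/matrixP => p q; rewrite !mxE ffunE; apply: eq_bigr => a _.
rewrite !mxE ffunE (bigID A) /=; congr (_ * _); apply: eq_bigr => j Aj.
  by rewrite tnth_mktuple Aj.
by rewrite tnth_mktuple (negbTE Aj).
Qed.

(** If [r < #|P|], the submatrices selected by [u] and [v] have determinant 0 along the
    approximating sequence, while their limit is the identity, of determinant 1. *)
Lemma border_rank_flattening (K : numFieldType) (m : nat) (J P : finType)
    (T : tensor K m J) (r : nat) (A : pred 'I_m) (u v : P -> m.-tuple J) :
  (forall p q, T (mix_tuple A (u p) (v q)) = (p == q)%:R) ->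
  border_rank_le T r -> (#|P| <= r)%N.
Proof.
move=> Tid [S [Sr ST]]; rewrite leqNgt; apply/negP => ltr.
pose M (T' : tensor K m J) : 'M[K]_#|P| :=
  \matrix_(p, q) T' (mix_tuple A (u (enum_val p)) (v (enum_val q))).
have M1 : M T = 1%:M.
  by apply/matrixP => p q; rewrite !mxE Tid (inj_eq enum_val_inj).
have cM : (\det (M (S s)) @[s --> \oo] --> \det (M T))%classic.
  apply: cvg_det => i j; rewrite mxE.
  by under eq_fun do rewrite mxE; exact: ST.
have M0 s : \det (M (S s)) = 0.
  have [U [V MUV]] := rank_le_flattening A
    (fun p : 'I_#|P| => u (enum_val p)) (fun q => v (enum_val q)) (Sr s).
  by rewrite [M _]MUV det_mulmx_lt.
have c0 : (\det (M (S s)) @[s --> \oo] --> (0 : K))%classic.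
  by under eq_fun do rewrite M0; exact: cvg_cst.
have : \det (M T) = 0 by exact: norm_cvg_unique cM c0.
by rewrite M1 det1 => /eqP; rewrite oner_eq0.
Qed.

Lemma rank_le_sum (K : comPzRingType) (m : nat) (J P : finType)
    (v : P -> 'I_m -> {ffun J -> K}) :
  rank_le [ffun w => \sum_p simple_tensor (v p) w] #|P|.
Proof.
exists (v \o enum_val); apply/ffunP => w; rewrite !ffunE.
by rewrite (reindex _ (onW_bij _ (enum_val_bij P))).
Qed.

Lemma rank_le_border (K : numFieldType) (m : nat) (J : finType)
    (T : tensor K m J) (r : nat) : rank_le T r -> border_rank_le T r.
Proof. by move=> Tr; exists (fun=> T); split=> // w; exact: cvg_cst. Qed.

Section KwiseTensor.
Variables (n k : nat).
Implicit Types (i : k.-tuple 'I_n) (l : 'I_n) (p q : k.-tuple 'I_n * 'I_n).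

Lemma size_cyclic_indices i l : (0 < k)%N -> size (cyclic_indices i l) = k.+1.
Proof.
move=> k0; rewrite size_cat /= size_takel ?size_tuple ?leq_pred //.
by rewrite addnS subnKC ?leq_pred.
Qed.

Lemma cyclic_indices_inj p q :
  cyclic_indices p.1 p.2 = cyclic_indices q.1 q.2 -> p = q.
Proof.
case: p q => [i l] [i' l'] /= /eqP.
rewrite /cyclic_indices eqseq_cat ?size_takel ?size_tuple ?leq_pred //.
rewrite eqseq_cons => /and3P[/eqP et /eqP -> /eqP ed]; congr pair.
by apply: val_inj; rewrite /= -(cat_take_drop k.-1 i) et ed cat_take_drop.
Qed.

Lemma nth_cyclic_indices_last i l x : (0 < k)%N ->
  nth x (cyclic_indices i l) k.-1 = l.
Proof.
by move=> k0; rewrite nth_cat size_takel ?size_tuple ?leq_pred // ltnn subnn.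
Qed.

(** Position [t] sits at offset [t - j] of window [j], before any wrap-around. *)
Lemma cyclic_window_nth p q (j : 'I_k) x (t : nat) : (0 < k)%N ->
  cyclic_window p.1 p.2 j = cyclic_window q.1 q.2 j ->
  (j <= t < j + k)%N -> (t < k.+1)%N ->
  nth x (cyclic_indices p.1 p.2) t = nth x (cyclic_indices q.1 q.2) t.
Proof.
move=> k0 ew /andP[jt tjk] tk.
have tk' : (t - j < k)%N by rewrite ltn_subLR.
have := congr1 (fun w => tnth w (Ordinal tk')) ew.
rewrite !tnth_mktuple /= subnKC // modn_small //.
by rewrite !(set_nth_default x) ?size_cyclic_indices.
Qed.

(* The index of the j-th factor in the simple tensor attached to the cyclic
   sequence of p; the last factor is the output. *)
Definition kwise_factor p (j : 'I_k.+1) : k.-tuple 'I_n :=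
  if unlift ord_max j is Some j' then cyclic_window p.1 p.2 j' else p.1.

Lemma widen_ord_lift_max (j : 'I_k) :
  widen_ord (leqnSn k) j = lift ord_max j.
Proof. by apply: ord_inj; rewrite lift_max. Qed.

Lemma kwise_factor_widen p (j : 'I_k) :
  kwise_factor p (widen_ord (leqnSn k) j) = cyclic_window p.1 p.2 j.
Proof. by rewrite widen_ord_lift_max /kwise_factor liftK. Qed.

Lemma kwise_factor_max p : kwise_factor p ord_max = p.1.
Proof. by rewrite /kwise_factor unlift_none. Qed.

Lemma kwise_tensorE (K : comPzRingType) (w : k.+1.-tuple (k.-tuple 'I_n)) :
  kwise_tensor K n k w =
  \sum_(l < n) [forall j : 'I_k, cyclic_window (tnth w ord_max) l j
                        == tnth w (widen_ord (leqnSn k) j)]%:R.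
Proof.
rewrite !ffunE; apply: eq_bigr => l _.
under eq_bigr => j _ do rewrite ffunE.
case: (boolP [forall j, _]) => [/forallP h|].
  by rewrite big1 // => j _; rewrite h.
rewrite negb_forall => /existsP[j hj].
by rewrite (bigD1 j) //= (negbTE hj) mul0r.
Qed.

(** This gives the upper bound. The output factor kills every [p] whose first component is not the
    output index of [w]; only [p.2] stays free, and it is the summation index of the product. *)
Lemma kwise_tensor_sum (K : comPzRingType) :
  kwise_tensor K n k = [ffun w => \sum_p
    simple_tensor (fun j => [ffun x => (x == kwise_factor p j)%:R]) w].
Proof.
apply/ffunP => w; rewrite 2!ffunE ffunE.
rewrite -(pair_bigA _ (fun i l => simple_tensor
  (fun j => [ffun x => (x == kwise_factor (i, l) j)%:R]) w)) /=.
rewrite (bigD1 (tnth w ord_max)) //= [X in _ + X]big1 ?addr0 => [|i ne].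
  apply: eq_bigr => l _; rewrite ffunE big_ord_recr /=.
  rewrite [X in _ * X]ffunE kwise_factor_max eqxx mulr1.
  by apply: eq_bigr => j _; rewrite !ffunE kwise_factor_widen eq_sym.
rewrite big1 // => l _; rewrite ffunE big_ord_recr /= [X in _ * X]ffunE.
by rewrite kwise_factor_max eq_sym (negbTE ne) mulr0.
Qed.

Hypothesis k_ge3 : (3 <= k)%N.

Let k_gt0 : (0 < k)%N. Proof. exact: leq_trans k_ge3. Qed.

(** Windows 0 and 1 come from [p], the other windows and the output from [q]. A nonzero entry needs
    one cyclic sequence fitting all of them, and each group alone determines it. *)
Lemma kwise_tensor_mix (K : comPzRingType) p q :
  kwise_tensor K n k
    (mix_tuple (fun j : 'I_k.+1 => j < 2)%N
       [tuple kwise_factor p j | j < k.+1] [tuple kwise_factor q j | j < k.+1])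
  = (p == q)%:R.
Proof.
rewrite kwise_tensorE; set w := mix_tuple _ _ _.
have -> : tnth w ord_max = q.1.
  by rewrite !tnth_mktuple !kwise_factor_max /= ltnNge ltnW.
under eq_bigr do
  (under eq_forallb do rewrite !tnth_mktuple !kwise_factor_widen /=).
rewrite (bigD1 q.2) //= big1 => [|l nel]; last first.
  (* Window 2 exists because [2 < k]. It comes from [q] and contains position [k.-1], where [l]
     sits, which forces [l = q.2]. *)
  case: forallP => // /(_ (Ordinal k_ge3)) /= /eqP e.
  have := @cyclic_window_nth (q.1, l) q _ q.2 k.-1 k_gt0 e.
  rewrite /= !nth_cyclic_indices_last // => el.
  rewrite el ?eqxx // in nel; last by rewrite ltnS leq_pred.
  by apply/andP; split; [rewrite -ltnS prednK | rewrite prednK // leq_addl].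
rewrite addr0; congr (_ %:R); congr nat_of_bool.
apply/forallP/eqP => [h|-> j]; last by case: ifP.
apply: cyclic_indices_inj.
apply: (@eq_from_nth _ q.2); first by rewrite !size_cyclic_indices.
move=> t; rewrite size_cyclic_indices // => tk; apply/esym.
(* Window 0 covers position 0, and window 1 covers all the others. *)
have [->|t0] := posnP t.
  have /eqP e := h (Ordinal k_gt0).
  by apply: (@cyclic_window_nth q p _ _ _ k_gt0 e); rewrite //= add0n.
have k_gt1 : (1 < k)%N by exact: leq_trans k_ge3.
have /eqP e := h (Ordinal k_gt1).
by apply: (@cyclic_window_nth q p _ _ _ k_gt0 e); rewrite //= t0 add1n.
Qed.

End KwiseTensor.

Theorem theorem8p2 (K : numFieldType) (n k : nat) (hk : (3 <= k)%N) :
  is_border_rank (kwise_tensor K n k) (n ^ k.+1)%N.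
Proof.
have <- : #|{: k.-tuple 'I_n * 'I_n}| = (n ^ k.+1)%N.
  by rewrite card_prod card_tuple card_ord expnSr.
split.
  by apply: rank_le_border; rewrite kwise_tensor_sum; exact: rank_le_sum.
move=> r; apply: border_rank_flattening => p q; exact: kwise_tensor_mix.
Qed.
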